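(* For all $n\ge1$ we have $|F_n(321,2143)|=2^{n-1}$.
   Context: A Fishburn permutation is a permutation $\pi$ (in one-line notation) with no subsequence $\pi_j,\pi_{j+1},\pi_k$ such that $j+1<k$, $\pi_j=\pi_k+1$, and $\pi_{j+1}>\pi_j$. $F_n(321,2143)$ is the set of Fishburn permutations of length $n$ avoiding the classical patterns $321$ and $2143$ (i.e. having no subsequence with the same relative order as either). *)

(* Defs.v *)
From mathcomp Require Import all_boot all_fingroup.

Set Implicit Arguments.
Unset Strict Implicit.
Unset Printing Implicit Defensive.

(* A permutation of length n is p : 'S_n, read in one-line notation as
   p 0, p 1, ..., p (n - 1).  Positions and values both start at 0 instead
   of 1; the conditions below only compare positions with positions and
   values with values, so they are invariant under this shift. *)

(* The pattern s is a word in one-line notation; f lists the positions of the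
   subsequence of p that has the same relative order as s. *)
Definition contains_pattern (n k : nat) (p : 'S_n) (s : k.-tuple nat) : bool :=
  [exists f : {ffun 'I_k -> 'I_n},
     [forall a : 'I_k, forall b : 'I_k,
        ((a < b) ==> (f a < f b))
        && ((p (f a) < p (f b)) == (tnth s a < tnth s b))]].

Definition avoids_pattern (n k : nat) (p : 'S_n) (s : k.-tuple nat) : bool :=
  ~~ contains_pattern p s.

(* j' is the position j + 1, which has to be a legal position. *)
Definition fishburn (n : nat) (p : 'S_n) : bool :=
  ~~ [exists j : 'I_n, exists j' : 'I_n, exists k : 'I_n,
        [&& (j' : nat) == j.+1, j.+1 < k, (p j : nat) == (p k).+1 & p j < p j']].

Definition fishburn_321_2143 (n : nat) : {set 'S_n} :=
  [set p : 'S_n | [&& fishburn p,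
                      avoids_pattern p [tuple 3; 2; 1] &
                      avoids_pattern p [tuple 2; 1; 4; 3]]].

(* Main.v *)
Require Import Defs.
From mathcomp Require Import all_boot all_fingroup.
From mathcomp Require Import zify.

Set Implicit Arguments.
Unset Strict Implicit.
Unset Printing Implicit Defensive.

(** Encode a permutation by its set A of non-records, i.e. of the positions
preceded by a larger entry; the first position is never in A.  A permutation of
the class is recovered from A: if A is empty it is the identity, and otherwise,
with a = min A, the positions i < a - 1 together with those in A carry the
smallest values in increasing order, and the remaining positions carry the
largest values in increasing order.  Every A without the first position arises
in this way, whence 2^(n-1) permutations. *)

Lemma contains_321P (n : nat) (p : 'S_n) :
  reflect (exists i j k : 'I_n, [/\ i < j < k, p j < p i & p k < p j])
          (contains_pattern p [tuple 3; 2; 1]).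
Proof.
apply: (iffP existsP) => [[f /forallP fP]|[i [j [k [/andP[ij jk] pji pkj]]]]].
- have P a b := forallP (fP a) b.
  pose o m (lt_m : m < 3) := f (Ordinal lt_m).
  have {}P a b (ha : a < 3) (hb : b < 3) := P (Ordinal ha) (Ordinal hb).
  exists (o 0 isT), (o 1 isT), (o 2 isT).
  have := P 0 1 isT isT; have := P 1 2 isT isT.
  have := P 1 0 isT isT; have := P 2 1 isT isT.
  rewrite !(tnth_nth 0) /= => /eqP-> /eqP-> /andP[-> _] /andP[-> _].
  by split.
- exists [ffun a => tnth [tuple i; j; k] a].
  apply/forallP => -[[|[|[|//]]] ha]; apply/forallP => -[[|[|[|//]]] hb];
    rewrite !ffunE !(tnth_nth i) !(tnth_nth 0) /=; lia.
Qed.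

Lemma contains_2143P (n : nat) (p : 'S_n) :
  reflect (exists i j k l : 'I_n,
             [/\ i < j, j < k < l, p j < p i & p i < p l < p k])
          (contains_pattern p [tuple 2; 1; 4; 3]).
Proof.
apply: (iffP existsP)
  => [[f /forallP fP]|[i [j [k [l [ij /andP[jk kl] pji /andP[pil plk]]]]]]].
- have P a b := forallP (fP a) b.
  pose o m (lt_m : m < 4) := f (Ordinal lt_m).
  have {}P a b (ha : a < 4) (hb : b < 4) := P (Ordinal ha) (Ordinal hb).
  exists (o 0 isT), (o 1 isT), (o 2 isT), (o 3 isT).
  have := P 0 1 isT isT; have := P 1 2 isT isT; have := P 2 3 isT isT.
  (* Read from the smallest value up, 2143 visits the indices 1, 0, 3, 2. *)
  have := P 1 0 isT isT; have := P 0 3 isT isT; have := P 3 2 isT isT.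
  rewrite !(tnth_nth 0) /=.
  move=> /eqP-> /andP[_ /eqP->] /eqP-> /andP[-> _] /andP[-> _] /andP[-> _].
  by split.
- exists [ffun a => tnth [tuple i; j; k; l] a].
  apply/forallP => -[[|[|[|[|//]]]] ha]; apply/forallP => -[[|[|[|[|//]]]] hb];
    rewrite !ffunE !(tnth_nth i) !(tnth_nth 0) /=; lia.
Qed.

(** * Permutations as linear orders on positions *)

Lemma card_ord_ltn (n m : nat) : m <= n -> #|[set x : 'I_n | x < m]| = m.
Proof.
move=> le_mn; rewrite -sum1dep_card -(big_ord_widen _ (fun=> 1)) //.
by rewrite sum1_card card_ord.
Qed.

Lemma perm_rank (n : nat) (p : 'S_n) (i : 'I_n) :
  #|[set j | p j < p i]| = p i.
Proof.
rewrite -[RHS](@card_ord_ltn n) ?(ltnW (ltn_ord _)) //.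
rewrite -(card_imset _ (@perm_inj _ p)); apply: eq_card => x.
rewrite inE; apply/imsetP/idP => [[j]|ltx].
  by rewrite inE => ? ->.
by exists ((p^-1)%g x); rewrite ?inE permKV.
Qed.

(** A value equals the number of smaller values, so comparisons alone fix the permutation. *)
Lemma perm_order_inj (n : nat) (p q : 'S_n) :
  (forall i j, (p i < p j) = (q i < q j)) -> p = q.
Proof.
move=> pq; apply/permP => i; apply/val_inj; rewrite /= -(perm_rank p) -(perm_rank q).
by apply: eq_card => j; rewrite !inE pq.
Qed.

(** Ranking works: send [i] to the number of positions with a smaller key. *)
Lemma perm_of_order (n : nat) (key : 'I_n -> nat) :
  injective key ->
  exists p : 'S_n, forall i j, (p i < p j) = (key i < key j).
Proof.
move=> key_inj; pose below i := [set j | key j < key i].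
have below_ltn i : #|below i| < n.
  rewrite -[X in _ < X]card_ord.
  have -> : #|below i|.+1 = #|i |: below i| by rewrite cardsU1 inE ltnn.
  exact: max_card.
have below_homo i j : key i < key j -> #|below i| < #|below j|.
  move=> ij; apply/proper_card/properP; split.
    by apply/subsetP => k; rewrite !inE => /ltn_trans; apply.
  by exists i; rewrite inE ?ltnn.
have below_mono i j : (#|below i| < #|below j|) = (key i < key j).
  case: (ltngtP (key i) (key j)) => [/below_homo//|/below_homo|/key_inj->].
    by move=> /ltnW; rewrite ltnNge => ->.
  by rewrite ltnn.
have rank_inj : injective (fun i => Ordinal (below_ltn i)).
  move=> i j /(congr1 val)/= ij; apply: key_inj.
  have := below_mono i j; have := below_mono j i; rewrite ij ltnn; lia.
by exists (perm rank_inj) => i j; rewrite !permE /= below_mono.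
Qed.

(** * Non-records and the order they encode *)

Definition nonrecords (n : nat) (p : 'S_n) : {set 'I_n} :=
  [set i : 'I_n | [exists j : 'I_n, (j < i) && (p i < p j)]].

Lemma nonrecordsP (n : nat) (p : 'S_n) (i : 'I_n) :
  reflect (exists2 j : 'I_n, j < i & p i < p j) (i \in nonrecords p).
Proof.
rewrite inE; apply: (iffP existsP) => [[j /andP[]]|[j ji pij]]; exists j => //.
by rewrite ji.
Qed.

(** For empty [A] the second clause is vacuous, so every position is low; this is the identity
    permutation. *)
Definition low (n : nat) (A : {set 'I_n}) (i : 'I_n) : bool :=
  (i \in A) || [forall a in A, i.+1 < a].

(** The shift by [n] lifts the other positions above all low ones, while each group keeps its
    left-to-right order. *)
Definition key (n : nat) (A : {set 'I_n}) (i : 'I_n) : nat :=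
  if low A i then i : nat else n + i.

Lemma key_inj (n : nat) (A : {set 'I_n}) : injective (key A).
Proof.
move=> i j; rewrite /key => ij; apply: val_inj => /=.
by have := ltn_ord i; have := ltn_ord j; move: ij; do 2 case: ifP => _; lia.
Qed.

Lemma key_ltn (n : nat) (A : {set 'I_n}) (i j : 'I_n) :
  (key A i < key A j) = if low A i == low A j then i < j else low A i.
Proof.
by rewrite /key; have := ltn_ord i; have := ltn_ord j;
  case: (low A i); case: (low A j) => /=; lia.
Qed.

Lemma low_min (n : nat) (A : {set 'I_n}) (i a : 'I_n) :
  i \notin A -> low A i -> a \in A -> i.+1 < a.
Proof. by move=> /negPf iA; rewrite /low iA => /forall_inP; apply. Qed.

Lemma notlowP (n : nat) (A : {set 'I_n}) (i : 'I_n) :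
  reflect (i \notin A /\ exists2 a, a \in A & a <= i.+1) (~~ low A i).
Proof.
rewrite negb_or negb_forall_in.
apply: (iffP andP) => -[iA].
  by move/existsP=> [a /andP[aA ai]]; split=> //; exists a => //; lia.
move=> [a aA ai]; split=> //; apply/existsP; exists a; rewrite aA /=; lia.
Qed.

(* The witness is the predecessor of [min A]. *)
Lemma notlow_before (n : nat) (A : {set 'I_n}) (a : 'I_n) :
  {in A, forall i : 'I_n, 0 < i} -> a \in A -> exists2 b : 'I_n, b < a & ~~ low A b.
Proof.
move=> A0 aA; case: (arg_minnP (@nat_of_ord n) aA) => m mA m_min.
have lt_b : m.-1 < n by have := ltn_ord m; lia.
have m0 := A0 m mA; exists (Ordinal lt_b) => /=; first by have := m_min a aA; lia.
apply/notlowP; split; last by exists m => //=; lia.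
by apply/negP => /m_min /=; lia.
Qed.

(** * From a permutation of the class to its order *)

Section ClassToOrder.

Variables (n : nat) (p : 'S_n).
Hypotheses (p_fish : fishburn p).
Hypotheses (p_321 : avoids_pattern p [tuple 3; 2; 1]).
Hypotheses (p_2143 : avoids_pattern p [tuple 2; 1; 4; 3]).

Let A := nonrecords p.

Lemma recordP (i j : 'I_n) : i \notin A -> j < i -> p j < p i.
Proof.
move=> iA ji; case: (ltngtP (p j) (p i)) => // [pij|/val_inj/perm_inj ij].
  by case/nonrecordsP: iA; exists j.
by rewrite ij ltnn in ji.
Qed.

(* Going up from the value [p j] to the value [p i], some value [v + 1] sits at
   a position [t <= i] while [v] sits after [i]; being Fishburn forces a
   descent right after [t]. *)
Lemma inversion_nonrecord (i j : 'I_n) :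
  i < j -> p j < p i -> exists2 a, a \in A & a <= i.+1.
Proof.
move=> ij; move: {2}(p i - p j) (leqnn (p i - p j)) => d.
elim: d j ij => [|d IHd] j ij led pji; first by lia.
have lt_v : (p j).+1 < n by have := ltn_ord (p i); lia.
pose t := (p^-1)%g (Ordinal lt_v).
have pt : p t = (p j).+1 :> nat by rewrite permKV.
(* If [t] lies after [i], the positions [i] and [t] form an inversion with a smaller gap in
   values. *)
case: (ltnP i t) => [it|ti].
  have neq : (p i : nat) <> p t by move=> /val_inj/perm_inj E; rewrite E ltnn in it.
  by apply: (IHd t) => //; lia.
have lt_t' : t.+1 < n by have := ltn_ord j; lia.
exists (Ordinal lt_t'); last by rewrite /=; lia.
apply/nonrecordsP; exists t => //=.
case: (ltnP t.+1 j) => [tj|jt]; last first.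
  suff -> : Ordinal lt_t' = j by rewrite pt.
  by apply: val_inj => /=; lia.
rewrite ltnNge; apply/negP => ptt.
move/negP: p_fish; apply.
apply/existsP; exists t; apply/existsP; exists (Ordinal lt_t').
apply/existsP; exists j; rewrite /= eqxx tj pt eqxx /=.
suff: (p t : nat) <> p (Ordinal lt_t') by lia.
by move=> /val_inj/perm_inj/(congr1 val) /=; lia.
Qed.

Lemma perm_gtP (i j : 'I_n) : i <> j -> ~ p i < p j -> p j < p i.
Proof.
move=> ij pij; suff : (p i : nat) <> p j by lia.
by move=> /val_inj/perm_inj.
Qed.

(** Suppose [p j < p i]. If [j] is a non-record, then [i] is low and left of [j]: either a larger
    entry before [i] completes a 321, or [inversion_nonrecord] contradicts that [i] is low. If [j]
    is a record, then [i] is a low position right of the non-low [j], and two inversions combine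
    into a 2143. *)
Lemma key_perm_homo (i j : 'I_n) : key A i < key A j -> p i < p j.
Proof.
move=> ltk; have neq_ij : i <> j by move=> E; rewrite E ltnn in ltk.
case: (boolP (p i < p j)) => // /negP/(perm_gtP neq_ij) pji.
move: ltk; rewrite key_ltn; case: (boolP (j \in A)) => jA.
- have -> : low A j by rewrite /low jA.
  case: (boolP (low A i)) => //= lowi ij.
  case: (boolP (i \in A)) => [/nonrecordsP[l li pil]|iA].
    by case/negP: p_321; apply/contains_321P; exists l, i, j; rewrite li ij.
  have [a aA] := inversion_nonrecord ij pji.
  by have := low_min iA lowi aA; lia.
- case: (ltnP i j) => [/(recordP jA)|ji]; first by lia.
  case: (boolP (low A i)) => [lowi|_]; last by case: (low A j).
  case: (boolP (low A j)) => //= /notlowP[_ [a aA aj]] _.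
  have {}ji : j < i by have : (i : nat) <> j by [move/val_inj]; lia.
  have iA : i \in A.
    by case: (boolP (i \in A)) => // iA; have := low_min iA lowi aA; lia.
  have /nonrecordsP[l li pil] := iA.
  have jl : j < l.
    have : (l : nat) <> j by move=> /val_inj E; rewrite E in pil; lia.
    by case: (ltnP l j) => [/(recordP jA)|]; lia.
  (* The inversion (b, a) lies below and to the left of the inversion (l, i). *)
  have /nonrecordsP[b ba pab] := aA.
  have pbj : p b <= p j.
    case: (ltnP b j) => [/(recordP jA)/ltnW//|jb].
    by suff -> : b = j by []; apply: val_inj => /=; lia.
  have al : a < l.
    have : (a : nat) <> l by move=> /val_inj E; rewrite E in pab; lia.
    by lia.
  case/negP: p_2143; apply/contains_2143P; exists b, a, l, i.
  by split=> //; apply/andP; split=> //; lia.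
Qed.

Lemma key_perm (i j : 'I_n) : (p i < p j) = (key A i < key A j).
Proof.
case: (ltngtP (key A i) (key A j)) => [/key_perm_homo//|/key_perm_homo|].
  by move=> /ltnW; rewrite ltnNge => ->.
by move/key_inj ->; rewrite ltnn.
Qed.

End ClassToOrder.

Lemma nonrecords_inj (n : nat) :
  {in fishburn_321_2143 n &, injective (@nonrecords n)}.
Proof.
move=> p q; rewrite !inE => /and3P[p1 p2 p3] /and3P[q1 q2 q3] pq.
by apply: perm_order_inj => i j; rewrite !key_perm // pq.
Qed.

(** * From a set of positions to a permutation of the class *)

Section OrderToClass.

Variables (n : nat) (A : {set 'I_n}) (p : 'S_n).
Hypothesis A0 : {in A, forall i : 'I_n, 0 < i}.
Hypothesis p_key : forall i j, (p i < p j) = (key A i < key A j).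

(** Values increase along each group, so an inversion has to cross from one group to the other. *)
Lemma inversion_low (i j : 'I_n) : i < j -> p j < p i -> ~~ low A i && low A j.
Proof. by rewrite p_key key_ltn; case: (low A i); case: (low A j) => //=; lia. Qed.

Lemma nonrecords_key : nonrecords p = A.
Proof.
apply/setP => i; apply/nonrecordsP/idP => [[j ji pij]|iA].
- have /andP[/notlowP[_ [a aA aj]] lowi] := inversion_low ji pij.
  case: (boolP (i \in A)) => // iA.
  by have := low_min iA lowi aA; lia.
- have [b bi lowb] := notlow_before A0 iA; exists b => //.
  by rewrite p_key key_ltn (negPf lowb) /low iA.
Qed.

(** In a forbidden pattern neither [j] nor [j'] is low. Hence some [a] in [A] with [a <= j.+1]
    differs from both, so [a < j], and a non-low [b] before [a] has its value strictly between the
    consecutive values [p k] and [p j]. *)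
Lemma fishburn_key : fishburn p.
Proof.
apply/existsP => -[j /existsP[j' /existsP[k /and4P[/eqP j'E jk /eqP pjk pjj']]]].
have /andP[lowj lowk] : ~~ low A j && low A k.
  by apply: inversion_low; [exact: ltnW | rewrite pjk].
have lowj' : ~~ low A j'.
  by move: pjj'; rewrite p_key key_ltn (negPf lowj); case: (low A j').
have /notlowP[jA [a aA aj]] := lowj.
have /notlowP[j'A _] := lowj'.
have neqa (i : 'I_n) : i \notin A -> (a : nat) <> i.
  by move=> iA /val_inj E; rewrite -E aA in iA.
have [b ba lowb] := notlow_before A0 aA.
have pkb : p k < p b by rewrite p_key key_ltn lowk (negPf lowb).
have pbj : p b < p j.
  rewrite p_key key_ltn (negPf lowb) (negPf lowj) eqxx.
  by have := neqa _ jA; have := neqa _ j'A; lia.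
by lia.
Qed.

(** The middle entry of a 321 ends one inversion and starts another, so it would be both low and not
    low. *)
Lemma avoids_321_key : avoids_pattern p [tuple 3; 2; 1].
Proof.
apply/contains_321P => -[i [j [k [/andP[ij jk] pji pkj]]]].
have /andP[_ lowj] := inversion_low ij pji.
by have := inversion_low jk pkj; rewrite lowj.
Qed.

(** The 2 would be at a non-low position and the 3 at a low one, against the order of the groups. *)
Lemma avoids_2143_key : avoids_pattern p [tuple 2; 1; 4; 3].
Proof.
apply/contains_2143P => -[i [j [k [l [ij /andP[jk kl] pji /andP[pil plk]]]]]].
have /andP[lowi _] := inversion_low ij pji.
have /andP[_ lowl] := inversion_low kl plk.
by move: pil; rewrite p_key key_ltn lowl (negPf lowi).
Qed.

End OrderToClass.

(** Nothing precedes the first position; conversely, ranking the positions by [key A] realises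
    [A]. *)
Lemma nonrecords_image (n : nat) :
  (@nonrecords n.+1) @: fishburn_321_2143 n.+1 = powerset (~: [set ord0]).
Proof.
apply/setP => A; rewrite powersetE; apply/imsetP/subsetP => [[p _ ->] i|A0].
  case/nonrecordsP => j ji _; rewrite !inE.
  by apply/eqP => i0; rewrite i0 in ji.
have {}A0 : {in A, forall i : 'I_n.+1, 0 < i}.
  by move=> i /A0; rewrite !inE lt0n.
have [p p_key] := perm_of_order (@key_inj n.+1 A).
exists p; last by rewrite (nonrecords_key A0 p_key).
rewrite inE (fishburn_key A0 p_key) (avoids_321_key p_key).
exact: avoids_2143_key p_key.
Qed.

Theorem corollary9p8 (n : nat) (hn : 1 <= n) :
  #|fishburn_321_2143 n| = 2 ^ (n - 1).
Proof.
case: n hn => // n _; rewrite subn1 /=.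
rewrite -(card_in_imset (@nonrecords_inj n.+1)) nonrecords_image.
by rewrite card_powerset cardsC1 card_ord.
Qed.
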